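(* Consider the system $x(t+1)=Ax(t)+Bu(t)+f(x(t))+v(t)$ with $v(t)\in\mathcal V$, where $f=W\phi$ is linearly parameterized by bounded features, together with an online parameter estimator with non-growing confidence sets (all as specified in the context), in closed loop with the matching certainty equivalent control law $$u(t)=\pi(x(t),t)=u^\star(x(t),t)-B^\dagger\hat f(x(t),t),\qquad u^\star(x(t),t)=u^\star_{t|t},$$ where $u^\star_{t|t}$ is the first element of an optimal policy sequence of the tube MPC problem $\mathrm{MPC}(t,x(t))$ defined in the context. Suppose that $\widehat W(t)-W\in\mathcal W(t)$ for all $t\ge 0$. If $\mathrm{MPC}(0,x(0))$ is feasible, then for all $t\ge 0$ the problem $\mathrm{MPC}(t,x(t))$ is feasible, and the closed-loop system satisfies $x(t)\in\mathcal X$ and $\pi(x(t),t)\in\mathcal U$.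
   Context: **System.** $A\in\mathbb R^{n\times n}$ and $B\in\mathbb R^{n\times m}$ are known, $B$ has full column rank, and $B^\dagger=(B^\top B)^{-1}B^\top$. The sets $\mathcal X\subseteq\mathbb R^n$, $\mathcal U\subseteq\mathbb R^m$, $\mathcal V\subset\mathbb R^n$ are compact, convex and contain the origin. The disturbances $v(t)\in\mathcal V$ are i.i.d. with zero mean. The stage cost is $h(x,u)=x^\top Qx+u^\top Ru$ with $Q$ symmetric positive semidefinite and $R$ symmetric positive definite. $\|\cdot\|$ is the Euclidean norm. **Structure of $f$.** $f(x)=W\phi(x)$ for all $x\in\mathbb R^n$, with $\phi:\mathbb R^n\to\mathbb R^d$ known, $W\in\mathbb R^{n\times d}$ unknown, and $\|\phi(x)\|\le 1$ for all $x\in\mathcal X$. **Estimator.** At each time $t\in\mathbb N_{\ge0}$ the estimator produces, from initial data $\widehat W(0),\mathcal W(0)$ and the trajectory history up to time $t$, an estimate $\widehat W(t)\in\mathbb R^{n\times d}$ with rows $\hat w_i(t)$, and bounded sets $\mathcal W_i(t)\subset\mathbb R^d$, $i=1,\dots,n$. Let $\mathcal W(t)=\{\widetilde W\in\mathbb R^{n\times d}: \tilde w_i\in\mathcal W_i(t)\ \forall i\}$, where $\tilde w_i$ is the $i$-th row of $\widetilde W$. The confidence sets do not grow: $\mathcal W(t+1)\subseteq\mathcal W(t)$ for all $t$. Put $\hat f(x,t)=\widehat W(t)\phi(x)$. **Sets.** (Maxima are read as suprema if not attained.) - $\widehat{\mathcal F}(t)=\{z\in\mathbb R^n: |z_i|\le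 \min_{j\in\{0,\dots,t\}}[\|\hat w_i(j)\|+2\max_{\tilde w_i\in\mathcal W_i(j)}\|\tilde w_i\|]\ \forall i\}$. - $\mathcal D(t)=\{z\in\mathbb R^n: |z_i|\le\max_{\tilde w_i\in\mathcal W_i(t)}\|\tilde w_i\|\ \forall i\}$. - $\widehat{\mathcal D}(t)=(I-BB^\dagger)\widehat{\mathcal F}(t)\oplus BB^\dagger\mathcal D(t)\oplus\mathcal V$. Here $\oplus$ is the Minkowski sum, $MS=\{Ms:s\in S\}$ for a matrix $M$ and a set $S$, and $S_1\ominus S_2=\{s: s+s_2\in S_1\ \forall s_2\in S_2\}$. **MPC problem.** Fix a horizon $N\ge1$. $\mathrm{MPC}(t,x(t))$ minimizes $V_N(\bar x_{t+N|t})+\sum_{k=0}^{N-1}h(\bar x_{t+k|t},\bar u_{t+k|t})$ over vectors $\bar u_{t+k|t}\in\mathbb R^m$ ($0\le k\le N-1$) and gains $K_{kj|t}\in\mathbb R^{m\times n}$ ($0\le j\le k-1$), subject to: $\bar x_{t|t}=x_{t|t}=x(t)$, and for every sequence $\{d_{t+k|t}\}_{k=0}^{N-1}\subset\widehat{\mathcal D}(t)$ and all $k\in\{0,\dots,N-1\}$, - $\bar x_{t+k+1|t}=A\bar x_{t+k|t}+B\bar u_{t+k|t}$, - $x_{t+k+1|t}=Ax_{t+k|t}+Bu_{t+k|t}+d_{t+k|t}$, - $u_{t+k|t}=\bar u_{t+k|t}+\sum_{j=0}^{k-1}K_{kj|t}d_{t+j|t}$, - $x_{t+k|t}\in\mathcal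 X$, $u_{t+k|t}\in\mathcal U\ominus B^\dagger\widehat{\mathcal F}(t)$, - $x_{t+N|t}\in\mathcal O(t)$. **Terminal ingredients.** $V_N:\mathbb R^n\to\mathbb R_{\ge 0}$ is a continuous convex Lyapunov function for the nominal dynamics under a policy $u_N(x)=-Kx$: there is a class-$\mathcal K_\infty$ function $\alpha_N$ with $\alpha_N(\|x\|)\ge h(x,u_N(x))$ and $V_N((A-BK)x)-V_N(x)\le-\alpha_N(\|x\|)$ for all $x\in\mathbb R^n$. For each $t\ge 0$, $\mathcal O(t)\subseteq\mathcal X$ is the maximal robust positive invariant set of $x(k+1)=(A-BK)x(k)+d(k)$, $d(k)\in\widehat{\mathcal D}(t)$, subject to $x(k)\in\mathcal X$ and $-Kx(k)\in\mathcal U\ominus B^\dagger\widehat{\mathcal F}(t)$. That is, it is the largest set of initial states from which these constraints hold for all $k\ge0$ and all disturbance sequences in $\widehat{\mathcal D}(t)$. *)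

(* Defs.v *)
From HB Require Import structures.
From mathcomp Require Export all_boot all_order all_algebra.
From mathcomp Require Export all_classical all_reals all_analysis.

Set Implicit Arguments.
Unset Strict Implicit.
Unset Printing Implicit Defensive.

Export Order.TTheory GRing.Theory Num.Theory.
Export numFieldNormedType.Exports.

#[global] Open Scope classical_set_scope.
#[global] Open Scope ring_scope.

(* The norm of the library on matrices is the sup norm; this is the Euclidean
   norm, and it is only ever applied to row and column vectors. *)
Definition enorm (R : realType) (p q : nat) (x : 'M[R]_(p, q)) : R :=
  Num.sqrt (\sum_i \sum_j x i j ^+ 2).

Definition pinv (R : realType) (n m : nat) (B : 'M[R]_(n, m)) : 'M[R]_(m, n) :=
  invmx (B^T *m B) *m B^T.

Definition psdmx (R : realType) (n : nat) (Q : 'M[R]_n) : Prop :=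
  Q^T = Q /\ forall x : 'cV[R]_n, 0 <= (x^T *m Q *m x) 0 0.

Definition pdmx (R : realType) (n : nat) (Q : 'M[R]_n) : Prop :=
  Q^T = Q /\ forall x : 'cV[R]_n, x != 0 -> 0 < (x^T *m Q *m x) 0 0.

Definition mxset (R : realType) (p q : nat) (M : 'M[R]_(p, q))
    (S : set 'cV[R]_q) : set 'cV[R]_p :=
  [set M *m s | s in S].

Definition minkowski_sum (R : realType) (p : nat) (S1 S2 : set 'cV[R]_p) :
    set 'cV[R]_p :=
  [set s1 + s2 | s1 in S1 & s2 in S2].

Definition minkowski_diff (R : realType) (p : nat) (S1 S2 : set 'cV[R]_p) :
    set 'cV[R]_p :=
  [set s | forall s2, S2 s2 -> S1 (s + s2)].

Definition class_Kinf (R : realType) (alpha : R -> R) : Prop :=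
  [/\ alpha 0 = 0,
      {within [set r : R | 0 <= r], continuous alpha},
      (forall r s : R, 0 <= r -> r < s -> alpha r < alpha s) &
      alpha r @[r --> +oo] --> +oo].

Section random_vectors.
Context (R : realType) (n : nat) (dsp : measure_display)
  (Omega : measurableType dsp) (Pr : probability Omega R).
Implicit Type v : nat -> Omega -> 'cV[R]_n.

Definition borel_cV : set (set 'cV[R]_n) := <<s (@open 'cV[R]_n) >>.

Definition random_vector (X : Omega -> 'cV[R]_n) : Prop :=
  forall A, borel_cV A -> measurable (X @^-1` A).

Definition mutually_independent v : Prop :=
  forall (s : seq nat) (A : nat -> set 'cV[R]_n),
    uniq s -> (forall t, borel_cV (A t)) ->
    Pr (\bigcap_(t in [set` s]) v t @^-1` A t) =
      (\prod_(t <- s) Pr (v t @^-1` A t))%E.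

Definition identically_distributed v : Prop :=
  forall t A, borel_cV A -> Pr (v t @^-1` A) = Pr (v 0%N @^-1` A).

Definition zero_mean v : Prop :=
  forall t i, Pr.-integrable [set: Omega] (fun w => (v t w i ord0)%:E) /\
    ('E_Pr[fun w => v t w i ord0] = 0)%E.

Definition iid_zero_mean v : Prop :=
  [/\ forall t, random_vector (v t), mutually_independent v,
      identically_distributed v & zero_mean v].

End random_vectors.

Section estimator.
Context (R : realType) (n m d : nat).

Record estimate := Estimate {
  est_W : 'M[R]_(n, d);
  est_rowset : 'I_n -> set 'rV[R]_d }.

Definition confidence_set (E : estimate) : set 'M[R]_(n, d) :=
  [set W | forall i, est_rowset E i (row i W)].

(* An estimator maps the initial data, the past states x(0), ..., x(t) and the
   past inputs u(0), ..., u(t-1) to the estimate at time t. *)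
Definition estimator := estimate -> seq 'cV[R]_n -> seq 'cV[R]_m -> estimate.

Definition run_estimator (est : estimator) (E0 : estimate)
    (x : nat -> 'cV[R]_n) (u : nat -> 'cV[R]_m) (t : nat) : estimate :=
  if t is 0%N then E0 else est E0 (mkseq x t.+1) (mkseq u t).

(* [sup] is the real supremum; it is meaningful here because the sets
   [est_rowset E i] are bounded. *)
Definition rowset_radius (E : estimate) (i : 'I_n) : R :=
  sup [set enorm w | w in est_rowset E i].

Implicit Type E : nat -> estimate.

Definition Fbound E (j : nat) (i : 'I_n) : R :=
  enorm (row i (est_W (E j))) + 2 * rowset_radius (E j) i.

Definition Fhat E (t : nat) : set 'cV[R]_n :=
  [set z | forall i,
    `|z i 0| <= \big[Num.min/Fbound E 0%N i]_(j < t.+1) Fbound E j i].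

Definition Dset E (t : nat) : set 'cV[R]_n :=
  [set z | forall i, `|z i 0| <= rowset_radius (E t) i].

End estimator.

Record mpc_data (R : realType) (n m : nat) := MPCData {
  matA : 'M[R]_n;
  matB : 'M[R]_(n, m);
  setX : set 'cV[R]_n;
  setU : set 'cV[R]_m;
  setV : set 'cV[R]_n;
  costQ : 'M[R]_n;
  costR : 'M[R]_m;
  horizon : nat;
  termK : 'M[R]_(m, n);
  termV : 'cV[R]_n -> R }.

(* Time is counted from the current instant t: index k stands for t+k|t.
   Only [pol_u p k] with k < horizon and [pol_K p k j] with j < k < horizon
   enter the constraints and the cost, so the values outside these ranges are
   immaterial. *)
Record policy (R : realType) (n m : nat) := Policy {
  pol_u : nat -> 'cV[R]_m;
  pol_K : nat -> nat -> 'M[R]_(m, n) }.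

Section tube_mpc.
Context (R : realType) (n m d : nat) (P : mpc_data R n m).
Implicit Types (E : nat -> estimate R n d) (t : nat) (z : 'cV[R]_n)
  (p : policy R n m) (dist : nat -> 'cV[R]_n).

Local Notation A := (matA P).
Local Notation B := (matB P).
Local Notation K := (termK P).
Local Notation N := (horizon P).

Definition stage_cost (x : 'cV[R]_n) (u : 'cV[R]_m) : R :=
  (x^T *m costQ P *m x) 0 0 + (u^T *m costR P *m u) 0 0.

Definition Dhat E t : set 'cV[R]_n :=
  minkowski_sum
    (minkowski_sum (mxset (1%:M - B *m pinv B) (Fhat E t))
                   (mxset (B *m pinv B) (Dset E t)))
    (setV P).

Definition tightU E t : set 'cV[R]_m :=
  minkowski_diff (setU P) (mxset (pinv B) (Fhat E t)).

Fixpoint terminal_state z dist (k : nat) : 'cV[R]_n :=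
  if k is k'.+1 then (A - B *m K) *m terminal_state z dist k' + dist k' else z.

Definition terminal_set E t : set 'cV[R]_n :=
  [set z | forall dist, (forall k, Dhat E t (dist k)) ->
    forall k, setX P (terminal_state z dist k) /\
              tightU E t (- (K *m terminal_state z dist k))].

Definition robust_positive_invariant E t (S : set 'cV[R]_n) : Prop :=
  forall z, S z ->
    [/\ setX P z, tightU E t (- (K *m z)) &
        forall w, Dhat E t w -> S ((A - B *m K) *m z + w)].

Lemma terminal_set_maximal E t : Dhat E t !=set0 ->
  robust_positive_invariant E t (terminal_set E t) /\
  forall S, robust_positive_invariant E t S -> S `<=` terminal_set E t.
Proof.
move=> [w0 Dw0]; split=> [z Oz|S rpiS z Sz dist Ddist k].
  have [Xz Uz] := Oz (fun=> w0) (fun=> Dw0) 0%N.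
  split=> // w Dw dist Ddist k.
  pose dist' j := if j is j'.+1 then dist j' else w.
  have Ddist' j : Dhat E t (dist' j) by case: j.
  suff -> : terminal_state ((A - B *m K) *m z + w) dist k =
            terminal_state z dist' k.+1 by exact: Oz.
  by elim: k => [//|k IHk]; rewrite /= IHk.
suff /rpiS[] : S (terminal_state z dist k) by [].
elim: k => [//|k /rpiS[_ _]] /=; exact.
Qed.

Fixpoint nominal_state z p (k : nat) : 'cV[R]_n :=
  if k is k'.+1 then A *m nominal_state z p k' + B *m pol_u p k' else z.

Definition policy_input p dist (k : nat) : 'cV[R]_m :=
  pol_u p k + \sum_(j < k) pol_K p k j *m dist j.

Fixpoint tube_state z p dist (k : nat) : 'cV[R]_n :=
  if k is k'.+1
  then A *m tube_state z p dist k' + B *m policy_input p dist k' + dist k'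
  else z.

Definition mpc_admissible E t z p : Prop :=
  forall dist, (forall k, (k < N)%N -> Dhat E t (dist k)) ->
    (forall k, (k < N)%N -> setX P (tube_state z p dist k) /\
                            tightU E t (policy_input p dist k)) /\
    terminal_set E t (tube_state z p dist N).

Definition mpc_cost z p : R :=
  termV P (nominal_state z p N) +
  \sum_(k < N) stage_cost (nominal_state z p k) (pol_u p k).

Definition mpc_feasible E t z : Prop := exists p, mpc_admissible E t z p.

Definition mpc_optimal E t z p : Prop :=
  mpc_admissible E t z p /\
  forall p', mpc_admissible E t z p' -> mpc_cost z p <= mpc_cost z p'.

Definition certainty_equivalent_input (phi : 'cV[R]_n -> 'cV[R]_d) E t
    (ustar : 'cV[R]_m) z : 'cV[R]_m :=
  ustar - pinv B *m (est_W (E t) *m phi z).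

End tube_mpc.

(* Main.v *)
Require Import Defs.
(* Under the matching certainty equivalent input, the closed loop is the tube
   dynamics driven by
     W phi - B B^+ What phi + v
       = (I - B B^+) W phi + B B^+ (W - What) phi + v,
   which lies in Dhat(t).  Since the confidence sets do not grow, Dhat(t)
   shrinks while the tightened input set and the terminal set grow, so shifting
   the previous policy and appending the terminal feedback -K x is feasible at
   the next time. *)
From mathcomp Require Import ring lra.

Set Implicit Arguments.
Unset Strict Implicit.
Unset Printing Implicit Defensive.

(** * Cauchy-Schwarz and the entries of a matrix-vector product *)

Section euclidean_norm.
Context (R : realType).

(** Cauchy-Schwarz by Lagrange's identity: twice the gap between the two sides is a sum of
    squares. *)
Lemma sum_mul_sqr_le (I : finType) (a b : I -> R) :
  (\sum_i a i * b i) ^+ 2 <= (\sum_i a i ^+ 2) * (\sum_i b i ^+ 2).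
Proof.
have lagrange : \sum_i \sum_j (a i * b j - a j * b i) ^+ 2 =
    2 * ((\sum_i a i ^+ 2) * (\sum_i b i ^+ 2) - (\sum_i a i * b i) ^+ 2).
  under eq_bigr => i _.
    under eq_bigr => j _.
      have -> : (a i * b j - a j * b i) ^+ 2 =
        a i ^+ 2 * b j ^+ 2 + b i ^+ 2 * a j ^+ 2 +
        (- 2 * (a i * b i)) * (a j * b j) by ring.
      over.
    rewrite !big_split /= -!mulr_sumr.
    over.
  rewrite !big_split /= -!mulr_suml -mulr_sumr; ring.
have : 0 <= \sum_i \sum_j (a i * b j - a j * b i) ^+ 2.
  by apply: sumr_ge0 => i _; apply: sumr_ge0 => j _; exact: sqr_ge0.
by rewrite lagrange; lra.
Qed.

Lemma enorm_ge0 p q (y : 'M[R]_(p, q)) : 0 <= enorm y.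
Proof. exact: sqrtr_ge0. Qed.

Lemma normr_mulmx_le_enorm p q (M : 'M[R]_(p, q)) (y : 'cV[R]_q) i :
  enorm y <= 1 -> `|(M *m y) i 0| <= enorm (row i M).
Proof.
move=> y1; rewrite /enorm -sqrtr_sqr; apply: ler_wsqrtr.
rewrite big_ord1; under [leRHS]eq_bigr do rewrite mxE.
rewrite mxE; apply: le_trans (sum_mul_sqr_le (M i) (y ^~ 0)) _.
rewrite ler_piMr ?sumr_ge0 // => [j _|]; first exact: sqr_ge0.
move: y1; rewrite /enorm -[leRHS]sqrtr1 ler_sqrt//.
by under eq_bigr do rewrite big_ord1.
Qed.

End euclidean_norm.

(** * Monotonicity of the uncertainty sets, and membership in them *)

Section confidence_sets.
Context (R : realType) (n m d : nat) (P : mpc_data R n m).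
Context (E : nat -> estimate R n d) (W : 'M[R]_(n, d)).
Hypothesis E_bounded : forall t i,
  has_ubound [set enorm w | w in est_rowset (E t) i].
Hypothesis E_nongrowing : forall t,
  confidence_set (E t.+1) `<=` confidence_set (E t).
Hypothesis W_confident : forall t, confidence_set (E t) (est_W (E t) - W).

Lemma rowset_radius_ge0 t i : 0 <= rowset_radius (E t) i.
Proof.
apply: le_trans (ub_le_sup (E_bounded t i) _); last first.
  by exists (row i (est_W (E t) - W)) => //; exact: W_confident.
exact: enorm_ge0.
Qed.

(* The confidence set is a product of row sets, so its monotonicity passes to
   each factor because the other factors are nonempty. *)
Lemma est_rowset_nongrowing t i :
  est_rowset (E t.+1) i `<=` est_rowset (E t) i.
Proof.
move=> w Ew.
pose M := \matrix_(k, l) if k == i then w 0 l else (est_W (E t.+1) - W) k l.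
have rowM k : row k M = if k == i then w else row k (est_W (E t.+1) - W).
  by apply/rowP => l; rewrite !mxE; case: eqP => // _; rewrite !mxE.
have /E_nongrowing/(_ i) : confidence_set (E t.+1) M.
  by move=> k; rewrite rowM; case: eqP => [->//|_]; exact: W_confident.
by rewrite rowM eqxx.
Qed.

Lemma rowset_radius_nonincreasing i j t : (j <= t)%N ->
  rowset_radius (E t) i <= rowset_radius (E j) i.
Proof.
elim: t => [|t IHt]; first by rewrite leqn0 => /eqP ->.
rewrite leq_eqVlt => /predU1P[-> //|/IHt]; apply: le_trans.
apply: sup_le_ub => [|_ [w Ew <-]].
  (* Bounding the supremum requires a nonempty set; the row of the true estimation error is a
     member. *)
  exists (enorm (row i (est_W (E t.+1) - W))).
  by exists (row i (est_W (E t.+1) - W)) => //; exact: W_confident.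
apply: ub_le_sup => //; exists w => //; exact: est_rowset_nongrowing.
Qed.

(** The minimum defining the box runs over the whole history, so a new time only adds a term,
    whatever the new estimate is. *)
Lemma Fhat_nonincreasing t : Fhat E t.+1 `<=` Fhat E t.
Proof.
move=> z Fz i; apply: le_trans (Fz i) _.
exact: (le_bigmin_ord xpredT (Fbound E ^~ i)) (leqnSn _).
Qed.

Lemma Dset_nonincreasing t : Dset E t.+1 `<=` Dset E t.
Proof.
by move=> z Dz i; exact: le_trans (Dz i) (rowset_radius_nonincreasing _ _).
Qed.

Lemma Dhat_nonincreasing t : Dhat P E t.+1 `<=` Dhat P E t.
Proof.
move=> _ [_ [_ [a Fa <-] [_ [b Db <-] <-]] [c Vc <-]].
exists ((1%:M - matB P *m pinv (matB P)) *m a + matB P *m pinv (matB P) *m b).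
  exists ((1%:M - matB P *m pinv (matB P)) *m a).
    by exists a => //; exact: Fhat_nonincreasing.
  exists (matB P *m pinv (matB P) *m b) => //.
  by exists b => //; exact: Dset_nonincreasing.
by exists c.
Qed.

Lemma tightU_nondecreasing t : tightU P E t `<=` tightU P E t.+1.
Proof.
move=> s Us _ [a Fa <-]; apply: Us.
by exists a => //; exact: Fhat_nonincreasing.
Qed.

Lemma terminal_set_nondecreasing t :
  terminal_set P E t `<=` terminal_set P E t.+1.
Proof.
move=> z Oz dist Ddist k.
have [Xz Uz] := Oz dist (fun j => Dhat_nonincreasing (Ddist j)) k.
by split=> //; exact: tightU_nondecreasing.
Qed.

Lemma est_error_in_Dset t (y : 'cV[R]_d) :
  enorm y <= 1 -> Dset E t ((W - est_W (E t)) *m y).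
Proof.
(* [W_confident] controls the error of opposite sign; the box [Dset] is symmetric. *)
move=> y1 i; rewrite -opprB mulNmx mxE normrN.
apply: le_trans (normr_mulmx_le_enorm _ _ y1) _.
apply: ub_le_sup => //; exists (row i (est_W (E t) - W)) => //.
exact: W_confident.
Qed.

Lemma in_Fhat t (z : 'cV[R]_n) :
  (forall j i, (j <= t)%N -> `|z i 0| <= Fbound E j i) -> Fhat E t z.
Proof.
(* The default value of the minimum is its own term of index 0, so the bound at [j = 0] covers it
   too. *)
move=> zF i; apply: le_bigmin => [|j _]; first exact: zF.
by apply: zF; rewrite -ltnS.
Qed.

Lemma true_param_bound j (y : 'cV[R]_d) i : enorm y <= 1 ->
  `|(W *m y) i 0| <= enorm (row i (est_W (E j))) + rowset_radius (E j) i.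
Proof.
move=> y1.
have -> : W *m y = est_W (E j) *m y + (W - est_W (E j)) *m y.
  by rewrite -mulmxDl addrC subrK.
rewrite mxE; apply: le_trans (ler_normD _ _) _; apply: lerD.
  exact: normr_mulmx_le_enorm.
exact: est_error_in_Dset.
Qed.

Lemma true_param_in_Fhat t (y : 'cV[R]_d) : enorm y <= 1 -> Fhat E t (W *m y).
Proof.
move=> y1; apply: in_Fhat => j i _; apply: le_trans (true_param_bound j i y1) _.
by have := rowset_radius_ge0 j i; rewrite /Fbound; lra.
Qed.

(* This is where the factor 2 in [Fbound] is needed: passing from the estimate
   at time t to the estimate at time j <= t costs both radii. *)
Lemma est_param_in_Fhat t (y : 'cV[R]_d) :
  enorm y <= 1 -> Fhat E t (est_W (E t) *m y).
Proof.
move=> y1; apply: in_Fhat => j i jt.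
have -> : est_W (E t) *m y = W *m y - (W - est_W (E t)) *m y.
  by rewrite -mulmxBl opprB addrC subrK.
rewrite mxE [X in _ + X]mxE; apply: le_trans (ler_normB _ _) _.
have := true_param_bound j i y1; have := est_error_in_Dset t y1 i.
by have := rowset_radius_nonincreasing i jt; rewrite /Fbound; lra.
Qed.

(** Cancellation acts only through [matB P *m pinv (matB P)], where just the estimation error is
    left, hence [Dset]; the complementary component keeps all of [W *m y], hence [Fhat]. *)
Lemma closed_loop_disturbance t (y : 'cV[R]_d) (w : 'cV[R]_n) :
  enorm y <= 1 -> setV P w ->
  Dhat P E t (W *m y - matB P *m pinv (matB P) *m (est_W (E t) *m y) + w).
Proof.
move=> y1 Vw.
exists ((1%:M - matB P *m pinv (matB P)) *m (W *m y) +
        matB P *m pinv (matB P) *m ((W - est_W (E t)) *m y)).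
  exists ((1%:M - matB P *m pinv (matB P)) *m (W *m y)).
    by exists (W *m y) => //; exact: true_param_in_Fhat.
  exists (matB P *m pinv (matB P) *m ((W - est_W (E t)) *m y)) => //.
  by exists ((W - est_W (E t)) *m y) => //; exact: est_error_in_Dset.
exists w => //; congr (_ + _).
by rewrite mulmxBl mul1mx mulmxBl mulmxBr addrA subrK.
Qed.

End confidence_sets.

(** * Shifting a disturbance-feedback policy by one step *)

Section shifted_policy.
Context (R : realType) (n m d : nat) (P : mpc_data R n m).
Implicit Types (p : policy R n m) (z : 'cV[R]_n) (dist : nat -> 'cV[R]_n).

Local Notation A := (matA P).
Local Notation B := (matB P).
Local Notation K := (termK P).
Local Notation N := (horizon P).

Lemma eq_tube_state z p p' dist k :
  (forall j, (j < k)%N -> policy_input p dist j = policy_input p' dist j) ->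
  tube_state P z p dist k = tube_state P z p' dist k.
Proof.
elim: k => [//|k IHk] pp' /=; rewrite IHk => [|j jk]; last exact: pp' (ltnW _).
by rewrite pp'.
Qed.

(** [c] and [G] are chosen before [dist], so a linear feedback of the state can be realized by fixed
    gains on the disturbances. *)
Lemma tube_state_affine z p k : exists (c : 'cV[R]_n) (G : nat -> 'M[R]_n),
  forall dist, tube_state P z p dist k = c + \sum_(j < k) G j *m dist j.
Proof.
elim: k => [|k [c [G cG]]].
  by exists z, (fun=> 0) => dist; rewrite big_ord0 addr0.
exists (A *m c + B *m pol_u p k),
  (fun j => if j == k then 1%:M else A *m G j + B *m pol_K p k j) => dist.
rewrite /= cG /policy_input big_ord_recr /= eqxx mul1mx addrA; congr (_ + _).
rewrite !mulmxDr addrACA; congr (_ + _).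
rewrite !mulmx_sumr -big_split /=; apply: eq_bigr => j _.
by rewrite ltn_eqF// mulmxDl !mulmxA.
Qed.

Definition prepend (w : 'cV[R]_n) dist (k : nat) : 'cV[R]_n :=
  if k is k'.+1 then dist k' else w.

(** Once [w] has been realized, the response to it is a known vector and moves from the gains into
    the open-loop input. *)
Definition shift_policy p (w : 'cV[R]_n) : policy R n m :=
  Policy (fun k => pol_u p k.+1 + pol_K p k.+1 0%N *m w)
         (fun k j => pol_K p k.+1 j.+1).

Lemma policy_input_shift p w dist k :
  policy_input (shift_policy p w) dist k =
  policy_input p (prepend w dist) k.+1.
Proof. by rewrite /policy_input big_ord_recl /= addrA. Qed.

Lemma tube_state_shift z p w dist k :
  tube_state P (A *m z + B *m pol_u p 0%N + w) (shift_policy p w) dist k =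
  tube_state P z p (prepend w dist) k.+1.
Proof.
elim: k => [|k IHk]; first by rewrite /= /policy_input big_ord0 addr0.
by rewrite [LHS]/= IHk policy_input_shift.
Qed.

(* The terminal feedback -K x is an affine function of the past disturbances,
   hence an admissible last input of a disturbance-feedback policy. *)
Lemma append_feedback z p h : exists p' : policy R n m, forall dist,
  (forall k, (k < h)%N -> policy_input p' dist k = policy_input p dist k) /\
  policy_input p' dist h = - (K *m tube_state P z p dist h).
Proof.
have [c [G cG]] := tube_state_affine z p h.
exists (Policy (fun k => if (k < h)%N then pol_u p k else - (K *m c))
  (fun k j => if (k < h)%N then pol_K p k j else - (K *m G j))) => dist.
split=> [k kh|]; rewrite /policy_input /= ?kh// ltnn cG mulmxDr opprD.
congr (_ + _); rewrite mulmx_sumr -sumrN; apply: eq_bigr => j _.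
by rewrite mulNmx mulmxA.
Qed.

Context (E : nat -> estimate R n d) (t : nat).
Hypothesis Dhat_sub : Dhat P E t.+1 `<=` Dhat P E t.
Hypothesis tightU_sub : tightU P E t `<=` tightU P E t.+1.
Hypothesis terminal_set_sub : terminal_set P E t `<=` terminal_set P E t.+1.

Lemma mpc_feasible_next z p w : (1 <= N)%N ->
  mpc_admissible P E t z p -> Dhat P E t w ->
  mpc_feasible P E t.+1 (A *m z + B *m pol_u p 0%N + w).
Proof.
move=> N1 adm Dw; set z' := _ + w.
have [h Nh] : exists h, N = h.+1 by exists N.-1; rewrite prednK.
have [p' p'E] := append_feedback z' (shift_policy p w) h.
exists p' => dist Ddist.
have [p'_lt p'_h] := p'E dist.
have state k : (k <= h)%N ->
    tube_state P z' p' dist k = tube_state P z p (prepend w dist) k.+1.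
  move=> kh; rewrite -tube_state_shift; apply: eq_tube_state => j jk.
  by rewrite p'_lt// (leq_trans jk).
(* The old tube is run on [w] followed by the new disturbances; [dist h] falls beyond its
   horizon. *)
have Dpre k : (k < N)%N -> Dhat P E t (prepend w dist k).
  by case: k => [//|k] kN; apply: Dhat_sub; apply: Ddist; exact: ltnW.
have [XU] := adm _ Dpre; rewrite {1}Nh -state// => /terminal_set_sub Oh.
(* Invariance of the terminal set is available only for nonempty [Dhat]; [dist h] is a witness. *)
have Dh : Dhat P E t.+1 (dist h) by apply: Ddist; rewrite Nh.
have [rpi _] := terminal_set_maximal (ex_intro _ _ Dh).
have [Xh Uh Oh'] := rpi _ Oh.
have p'_hE : policy_input p' dist h = - (K *m tube_state P z' p' dist h).
  by rewrite p'_h tube_state_shift state.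
split=> [k|].
  rewrite {1}Nh ltnS leq_eqVlt => /predU1P[->|kh]; first by rewrite p'_hE.
  have [Xk Uk] : setX P (tube_state P z p (prepend w dist) k.+1) /\
      tightU P E t (policy_input p (prepend w dist) k.+1).
    by apply: XU; rewrite Nh.
  rewrite state 1?ltnW// p'_lt// policy_input_shift; split=> //.
  exact: tightU_sub.
rewrite {1}Nh /= p'_hE mulmxN mulmxA -mulmxBl.
exact: Oh'.
Qed.

End shifted_policy.

(** * Recursive feasibility and constraint satisfaction in closed loop *)

Theorem theorem2 (R : realType) (n m d : nat) (P : mpc_data R n m)
  (rankB : \rank (matB P) = m)
  (compactX : compact (setX P)) (convexX : convex_set (setX P))
  (X0 : setX P 0)
  (compactU : compact (setU P)) (convexU : convex_set (setU P))
  (U0 : setU P 0)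
  (compactV : compact (setV P)) (convexV : convex_set (setV P))
  (V0 : setV P 0)
  (psdQ : psdmx (costQ P)) (pdR : pdmx (costR P))
  (horizon_ge1 : (1 <= horizon P)%N)
  (termV_ge0 : forall x, 0 <= termV P x)
  (termV_continuous : continuous (termV P))
  (termV_convex : convex_function [set: 'cV[R]_n] (termV P))
  (termV_lyapunov : exists alpha : R -> R, class_Kinf alpha /\
    forall x : 'cV[R]_n,
      stage_cost P x (- (termK P *m x)) <= alpha (enorm x) /\
      termV P ((matA P - matB P *m termK P) *m x) - termV P x
        <= - alpha (enorm x))
  (f : 'cV[R]_n -> 'cV[R]_n) (phi : 'cV[R]_n -> 'cV[R]_d) (W : 'M[R]_(n, d))
  (f_linear : forall x, f x = W *m phi x)
  (phi_bounded : forall x, setX P x -> enorm (phi x) <= 1)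
  (dsp : measure_display) (Omega : measurableType dsp)
  (Pr : probability Omega R) (v : nat -> Omega -> 'cV[R]_n)
  (v_iid : iid_zero_mean Pr v)
  (v_in_V : forall t w, setV P (v t w))
  (omega : Omega)
  (est : estimator R n m d) (E0 : estimate R n d)
  (x : nat -> 'cV[R]_n) (u ustar : nat -> 'cV[R]_m)
  (E : nat -> estimate R n d)
  (E_run : forall t, E t = run_estimator est E0 x u t)
  (E_bounded : forall t i,
    has_ubound [set enorm w | w in est_rowset (E t) i])
  (E_nongrowing : forall t,
    confidence_set (E t.+1) `<=` confidence_set (E t))
  (closed_loop : forall t,
    x t.+1 = matA P *m x t + matB P *m u t + f (x t) + v t omega)
  (control_law : forall t,
    u t = certainty_equivalent_input P phi E t (ustar t) (x t))
  (ustar_optimal : forall t, mpc_feasible P E t (x t) ->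
    exists p, mpc_optimal P E t (x t) p /\ ustar t = pol_u p 0%N)
  (W_confident : forall t, confidence_set (E t) (est_W (E t) - W)) :
  mpc_feasible P E 0%N (x 0%N) ->
  forall t, [/\ mpc_feasible P E t (x t), setX P (x t) &
    setU P (certainty_equivalent_input P phi E t (ustar t) (x t))].
Proof.
move=> feas0 t.
have admissible_now s p : mpc_admissible P E s (x s) p ->
    setX P (x s) /\ tightU P E s (pol_u p 0%N).
  move=> adm.
  (* Admissibility says something about [x s] only if some disturbance sequence exists. The feature
     bound at [x s] is not yet available, so zero features and zero noise are used. *)
  have Dw : Dhat P E s
      (W *m 0 - matB P *m pinv (matB P) *m (est_W (E s) *m 0) + 0).
    apply: closed_loop_disturbance => //.
    rewrite /enorm big1 ?sqrtr0// => i _.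
    by rewrite big1// => j _; rewrite mxE expr0n.
  have [/(_ _ horizon_ge1)[Xx]] := adm _ (fun _ _ => Dw).
  by rewrite /policy_input big_ord0 addr0.
have feas s : mpc_feasible P E s (x s).
  elim: s => [//|s /ustar_optimal[p [[adm _] us]]].
  have [Xx _] := admissible_now _ _ adm.
  have y1 := phi_bounded _ Xx.
  have Dw :=
    closed_loop_disturbance E_bounded W_confident s y1 (v_in_V s omega).
  have -> : x s.+1 = matA P *m x s + matB P *m pol_u p 0%N +
      (W *m phi (x s) -
       matB P *m pinv (matB P) *m (est_W (E s) *m phi (x s)) + v s omega).
    rewrite closed_loop control_law /certainty_equivalent_input us f_linear.
    rewrite mulmxBr (mulmxA (matB P) (pinv _)) !addrA; congr (_ + _).
    exact: addrAC.
  apply: mpc_feasible_next adm Dw => //.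
  - exact: Dhat_nonincreasing.
  - exact: tightU_nondecreasing.
  - exact: terminal_set_nondecreasing.
have [p [[adm _] us]] := ustar_optimal _ (feas t).
have [Xx Uu] := admissible_now _ _ adm.
split=> //; rewrite /certainty_equivalent_input us -mulmxN; apply: Uu.
(* The tightening leaves room for the matching term; its minus sign is absorbed by the symmetry of
   [Fhat]. *)
exists (- (est_W (E t) *m phi (x t))) => // i.
rewrite mxE normrN; apply: est_param_in_Fhat => //; exact: phi_bounded.
Qed.
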